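(* Let $A\in\mathbb{R}^{m\times n}$ be semi-monotone, let $A=P_1-R_1+S_1$ be a double proper weak regular splitting and $A=P_2-R_2+S_2$ a double proper regular splitting of $A$. Suppose $N(R_2)\supseteq N(P_2)$, $R(R_2)\subseteq R(P_2)$, $-1\notin\sigma(R_2P_1^{\dagger})$ and $\widehat{\mathcal{A}}^{\dagger}\geq 0$, where $\widehat{\mathcal{A}}=(I+R_2P_1^{\dagger})A$. If $P_1^{\dagger}R_1\geq P_2^{\dagger}R_2$, $P_2^{\dagger}S_2\geq P_1^{\dagger}S_1$ and $P_2^{\dagger}R_2+P_2^{\dagger}S_2\leq 0$, then $\rho(\mathcal{W}_{12})\leq\min\{\rho(T_1),\rho(T_2)\}<1$, where $$\mathcal{W}_{12}=\begin{pmatrix} P_2^{\dagger}R_2P_1^{\dagger}R_1-P_2^{\dagger}S_2 & -P_2^{\dagger}R_2P_1^{\dagger}S_1\\ I & 0\end{pmatrix},\qquad T_i=\begin{pmatrix} P_i^{\dagger}R_i & -P_i^{\dagger}S_i\\ I&0\end{pmatrix}\ (i=1,2).$$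
   Context: For $M\in\mathbb{R}^{m\times n}$, $M^{\dagger}$ is its Moore–Penrose inverse, $R(M)$, $N(M)$ its range and null space; inequalities are entrywise; $\rho$ is the spectral radius, $\sigma$ the spectrum. $A$ is semi-monotone if $A^{\dagger}\geq0$. A double splitting $A=P-R+S$ is a double proper splitting if $R(P)=R(A)$ and $N(P)=N(A)$; it is double proper regular if moreover $P^{\dagger}\geq0$, $R\geq0$, $S\leq0$; double proper weak regular if moreover $P^{\dagger}\geq 0$, $P^{\dagger}R\geq 0$, $P^{\dagger}S\leq 0$. *)

(* Defs.v *)
From HB Require Import structures.
From mathcomp Require Import all_boot all_order all_algebra.
From mathcomp Require Import complex.
Set Implicit Arguments. Unset Strict Implicit. Unset Printing Implicit Defensive.
Import Order.TTheory GRing.Theory Num.Theory.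
Local Open Scope ring_scope.

(* Real matrices are taken over an arbitrary real closed field R (e.g. the reals);
   eigenvalues live in the algebraic closure R[i]. *)

Definition is_MP_inverse (R : rcfType) (m n : nat)
  (A : 'M[R]_(m, n)) (X : 'M[R]_(n, m)) : Prop :=
  [/\ A *m X *m A = A, X *m A *m X = X,
      (A *m X)^T = A *m X & (X *m A)^T = X *m A].

Definition mxle (R : rcfType) (m n : nat) (A B : 'M[R]_(m, n)) : Prop :=
  forall i j, A i j <= B i j.

(* column space R(A), represented (mxalgebra style) as the row space of A^T *)
Definition colspace (R : rcfType) (m n : nat) (A : 'M[R]_(m, n)) := A^T.
(* null space N(A) = {x | A x = 0}, represented as the row space of kermx A^T *)
Definition nullspace (R : rcfType) (m n : nat) (A : 'M[R]_(m, n)) := kermx A^T.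

Definition double_proper_splitting (R : rcfType) (m n : nat)
  (A P Rm S : 'M[R]_(m, n)) : Prop :=
  [/\ A = P - Rm + S, (colspace P == colspace A)%MS
    & (nullspace P == nullspace A)%MS].

Definition double_proper_regular (R : rcfType) (m n : nat)
  (A P Rm S : 'M[R]_(m, n)) (Pd : 'M[R]_(n, m)) : Prop :=
  [/\ double_proper_splitting A P Rm S, is_MP_inverse P Pd,
      mxle 0 Pd, mxle 0 Rm & mxle S 0].

Definition double_proper_weak_regular (R : rcfType) (m n : nat)
  (A P Rm S : 'M[R]_(m, n)) (Pd : 'M[R]_(n, m)) : Prop :=
  [/\ double_proper_splitting A P Rm S, is_MP_inverse P Pd,
      mxle 0 Pd, mxle 0 (Pd *m Rm) & mxle (Pd *m S) 0].

Definition cmx (R : rcfType) (m n : nat) (A : 'M[R]_(m, n)) : 'M[R[i]]_(m, n) :=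
  map_mx (fun x => x%:C%C) A.

Definition spectrum (R : rcfType) (n : nat) (A : 'M[R]_n) : pred R[i] :=
  fun z => eigenvalue (cmx A) z.

(* the list of eigenvalues (with multiplicity): roots of the characteristic polynomial *)
Definition eigenvalues (R : rcfType) (n : nat) (A : 'M[R]_n) : seq R[i] :=
  sval (closed_field_poly_normal (char_poly (cmx A))).

Definition specrad (R : rcfType) (n : nat) (A : 'M[R]_n) : R :=
  \big[Order.max/0]_(z <- eigenvalues A) Normc.normc z.

(* Main.v *)
Require Import Defs.
From HB Require Import structures.
From mathcomp Require Import all_boot all_order all_algebra.
From mathcomp Require Import complex polyrcf ring lra.
Import Order.TTheory GRing.Theory Num.Theory.
Local Open Scope ring_scope.

(** Put X_i = P_i^+ R_i and Y_i = - P_i^+ S_i; everything is a comparison of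
    block companion matrices [[X, Y], [I, 0]] with X, Y >= 0. A Collatz-Wielandt
    argument gives rho < t as soon as some y >= 0 satisfies
    (t X + Y) y < t^2 y entrywise; conversely, for rho < t the resolvent at t is
    nonnegative, so t^2 b = t X b + Y b + w is solvable with b >= 0 for any w >= 0.
    Monotonicity then gives rho(T_2) <= rho(T_1), so the minimum is rho(T_2), and
    the splitting A = P_2 - (R_2 - S_2) yields rho(T_2) < 1. For
    rho(T_2) < t < 1 solve the equation of T_2 with a positive w for which
    P_2 w >= 0: the regularity of the second splitting makes A b >= 0, and the
    same b is a Collatz-Wielandt vector of W_12 at t, because the equation
    of T_2 exceeds the expression for W_12 by
    (1 - t) (Y_2 - X_2) b + (1 - t) X_2 X_1 b + X_2 P_1^+ A b >= 0. *)

(** * Entrywise nonnegative matrices *)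

Lemma mxle0_mul {R : rcfType} {m n p : nat} (A : 'M[R]_(m, n)) (B : 'M[R]_(n, p)) :
  mxle 0 A -> mxle 0 B -> mxle 0 (A *m B).
Proof.
move=> A0 B0 i j; rewrite !mxE; apply: sumr_ge0 => k _.
by apply: mulr_ge0; [have := A0 i k | have := B0 k j]; rewrite mxE.
Qed.

Lemma mxle0_add {R : rcfType} {m n : nat} (A B : 'M[R]_(m, n)) :
  mxle 0 A -> mxle 0 B -> mxle 0 (A + B).
Proof.
by move=> A0 B0 i j; have := A0 i j; have := B0 i j; rewrite !mxE; lra.
Qed.

Lemma mxle0_scale {R : rcfType} {m n : nat} (a : R) (A : 'M[R]_(m, n)) :
  0 <= a -> mxle 0 A -> mxle 0 (a *: A).
Proof. by move=> a0 A0 i j; have := A0 i j; rewrite !mxE; exact: mulr_ge0. Qed.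

Lemma mxle0_of_scale {R : rcfType} {m n : nat} (a : R) (A : 'M[R]_(m, n)) :
  0 < a -> mxle 0 (a *: A) -> mxle 0 A.
Proof.
by move=> a0 A0 i j; have := A0 i j; rewrite [(a *: A) i j]mxE mxE pmulr_rge0.
Qed.

Lemma mxle_subr0 {R : rcfType} {m n : nat} (A B : 'M[R]_(m, n)) :
  mxle 0 (B - A) <-> mxle A B.
Proof.
by split=> AB i j; have := AB i j; rewrite !mxE; lra.
Qed.

(** * Nonnegativity of the resolvent *)

(** Minimum principle: at an index [i] where [x] has a negative minimum, [M *m x] is at least the
    row sum times [x i 0], which exceeds [s * x i 0]. *)
Lemma diag_dominant_ge0 {R : rcfType} {n : nat} (M : 'M[R]_n) (s : R) (x : 'cV[R]_n) :
  mxle 0 M -> (forall i, \sum_j M i j < s) -> mxle 0 ((s%:M - M) *m x) -> mxle 0 x.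
Proof.
move=> M0 Ms; rewrite mulmxBl mul_scalar_mx => Hx i0 k; rewrite (ord1 k) {k} mxE.
have [i _ xi] := arg_minP (fun i => x i 0) (isT : predT i0).
apply: le_trans (xi i0 isT); rewrite leNgt; apply/negP => xi0.
have := Hx i 0; rewrite !mxE leNgt => /negP; apply; rewrite subr_lt0.
apply: (@lt_le_trans _ _ ((\sum_j M i j) * x i 0)); first by rewrite ltr_nM2r.
rewrite mulr_suml; apply: ler_sum => j _; apply: ler_wpM2l; last exact: xi.
by have := M0 i j; rewrite mxE.
Qed.

Lemma exists_last_root {R : rcfType} (p : {poly R}) (a : R) :
  p != 0 -> root p a ->
  exists s, [/\ a <= s, root p s & forall x, s < x -> ~~ root p x].
Proof.
move=> p0 pa; have rP := roots_on_rootsR p0.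
exists (\big[Num.max/a]_(x <- rootsR p) x); split.
- exact: bigmax_ge_id.
- rewrite big_seq_cond; apply: (big_ind (fun x => root p x)) => //.
    by move=> x y px py; rewrite /Order.max; case: ifP.
  by move=> x; rewrite andbT -rP => /andP[].
- move=> x lt_x; apply/negP => px; move: lt_x; rewrite ltNge => /negP; apply.
  by apply: (@bigmax_sup_seq _ _ _ _ _ x) => //; rewrite -rP px in_itv.
Qed.

Lemma horner_char_poly_mx {R : comNzRingType} {n : nat} (M : 'M[R]_n) (s : R) :
  map_mx (horner_eval s) (char_poly_mx M) = s%:M - M.
Proof.
apply/matrixP => i j; rewrite !mxE /horner_eval hornerD hornerN hornerC.
by rewrite hornerMn hornerX.
Qed.

(* The entries of the resolvent are quotients of polynomials. At a last zero of
   one of them the whole resolvent is nonnegative, so the resolvent identity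
   makes that entry nonincreasing to the right, hence identically zero. *)
Lemma resolvent_ge0 {R : rcfType} {n : nat} (M : 'M[R]_n) (t : R) :
  mxle 0 M -> (forall s, t <= s -> s%:M - M \in unitmx) ->
  mxle 0 (invmx (t%:M - M)).
Proof.
move=> M0 Mt; pose N s := invmx (s%:M - M).
(* Multiplying the adjugate entry by [d] instead of dividing gives a polynomial with the sign of
   [N s i j] for every [s >= t]. *)
pose d := char_poly M; pose q i j := \adj (char_poly_mx M) i j * d.
have dE s : d.[s] = \det (s%:M - M).
  by rewrite -(horner_char_poly_mx M s) det_map_mx.
have d0 : d != 0 by exact/monic_neq0/char_poly_monic.
have qE s i j : t <= s -> (q i j).[s] = d.[s] ^+ 2 * N s i j.
  move=> ts; have ds : d.[s] != 0 by rewrite dE -unitfE; exact: Mt.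
  rewrite hornerM /N /invmx (Mt s ts) [in RHS]mxE -dE.
  have -> : (\adj (char_poly_mx M) i j).[s] = \adj (s%:M - M) i j.
    by rewrite -(horner_char_poly_mx M s) -map_mx_adj [RHS]mxE.
  by field.
have d2 s : t <= s -> 0 < d.[s] ^+ 2.
  by move=> ts; rewrite exprn_even_gt0 //= dE -unitfE; exact: Mt.
(* [B] exceeds every row sum of [M], so the minimum principle settles all [s >= B]. *)
pose B := 1 + \sum_i \sum_j M i j.
have NB s : t <= s -> B <= s -> mxle 0 (N s).
  move=> ts Bs i j.
  suff /(_ i 0) : mxle 0 (col j (N s)) by rewrite !mxE.
  apply: (@diag_dominant_ge0 _ _ M s) => //.
    move=> k; apply: (lt_le_trans _ Bs); rewrite /B [\sum_i _](bigD1 k) //=.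
    rewrite addrCA ltrDl ltr_wpDr //.
    by do 2!apply: sumr_ge0 => ? _; apply: le_trans (M0 _ _); rewrite mxE.
  rewrite colE mulmxA mulmxV ?Mt // mul1mx => k l; rewrite !mxE.
  by rewrite ler0n.
(* A negative entry at [s] would force a sign change of [q i j] between [s] and [Num.max s B]. *)
have Nge s i j : t <= s -> (q i j != 0 -> forall x, s < x -> ~~ root (q i j) x) ->
    0 <= N s i j.
  move=> ts Hq; rewrite leNgt; apply/negP => Ns.
  have qs : (q i j).[s] < 0 by rewrite qE // pmulr_rlt0 // d2.
  have qn0 : q i j != 0 by apply: contraTneq qs => ->; rewrite horner0 ltxx.
  have tb : t <= Num.max s B by rewrite le_max ts.
  have sB : s <= Num.max s B by rewrite le_max lexx.
  have qB : 0 <= (q i j).[Num.max s B].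
    rewrite qE //; apply: mulr_ge0; first by apply/ltW/d2.
    have BB : B <= Num.max s B by rewrite le_max lexx orbT.
    by have := NB _ tb BB i j; rewrite [X in X <= _]mxE.
  have [x /andP[sx _] qx] : exists2 x, s <= x <= Num.max s B & root (q i j) x.
    by apply: poly_ivt => //; rewrite ltW.
  move: sx; rewrite le_eqVlt => /orP[/eqP sx|sx]; last first.
    by move: (Hq qn0 x sx); rewrite qx.
  by move: qs; rewrite sx (rootP qx) ltxx.
(* One polynomial collects the zeros of all entries that do not vanish identically; its last root
   serves every entry at once. *)
pose Q := \prod_i \prod_(j | q i j != 0) q i j.
have Q0 : Q != 0 by apply/prodf_neq0 => i _; apply/prodf_neq0.
have Qroot i j x : q i j != 0 -> root (q i j) x -> root Q x.
  move=> qn0 /rootP qx; apply/rootP.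
  by rewrite /Q (bigD1 i) //= hornerM (bigD1 j) //= hornerM qx !mul0r.
suff Qt x : t <= x -> ~~ root Q x.
  move=> i j; rewrite mxE; apply: Nge => // qn0 x /ltW tx.
  by apply: contra (Qt _ tx); exact: Qroot.
move=> tx; apply/negP => /(exists_last_root _ _ Q0) [s [xs Qs slast]].
have ts := le_trans tx xs.
have ts1 : t <= s + 1 by lra.
have Nlast r i j : s <= r -> 0 <= N r i j.
  move=> sr; apply: Nge => [|qn0 y ry]; first exact: le_trans sr.
  by apply: contra (slast y (le_lt_trans sr ry)); exact: Qroot.
have [i [j [qn0 qs]]] : exists i j, q i j != 0 /\ (q i j).[s] = 0.
  move: Qs => /rootP; rewrite horner_prod => /eqP/prodf_eq0 [i _].
  by rewrite horner_prod => /prodf_eq0 [j qn0 /eqP qs]; exists i, j.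
have Ns0 : N s i j = 0.
  by apply/eqP; move: qs; rewrite qE // => /eqP; rewrite mulf_eq0 gt_eqF ?d2.
have : N s - N (s + 1) = N (s + 1) *m N s.
  have sE : (s + 1)%:M - M = (s%:M - M) + 1%:M.
    by rewrite raddfD /= addrAC.
  have : N (s + 1) *m ((s + 1)%:M - M) *m N s = N s by rewrite mulVmx ?Mt ?mul1mx.
  rewrite sE mulmxDr mulmxDl mulmx1 -mulmxA mulmxV ?Mt // mulmx1 => NE.
  by rewrite -{1}NE addrC addKr.
move/matrixP/(_ i j); rewrite !mxE Ns0 => NE.
have : 0 <= - N (s + 1) i j.
  rewrite -[- _]add0r NE; apply: sumr_ge0 => k _.
  by apply: mulr_ge0; apply: Nlast; lra.
rewrite oppr_ge0 => Nle.
have Ns1 : N (s + 1) i j = 0 by apply/le_anti; rewrite Nle Nlast //; lra.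
have : ~~ root (q i j) (s + 1).
  by apply: contra (slast (s + 1) _); [exact: Qroot | lra].
by rewrite /root qE // Ns1 mulr0 eqxx.
Qed.

(** * Eigenvalues and the spectral radius *)

Lemma eigenvalue_cmxE {R : rcfType} {n : nat} (A : 'M[R]_n) (z : R[i]) :
  eigenvalue (cmx A) z = (z \in eigenvalues A).
Proof.
rewrite eigenvalue_root_char /eigenvalues; case: closed_field_poly_normal => r /= {1}->.
by rewrite (monicP (char_poly_monic _)) scale1r root_prod_XsubC.
Qed.

Lemma specrad_ge0 {R : rcfType} {n : nat} (A : 'M[R]_n) : 0 <= specrad A.
Proof. exact: bigmax_ge_id. Qed.

Lemma specrad_lt {R : rcfType} {n : nat} (A : 'M[R]_n) (t : R) :
  0 < t -> (forall z, eigenvalue (cmx A) z -> Normc.normc z < t) -> specrad A < t.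
Proof.
move=> t0 At; rewrite /specrad big_seq; apply: bigmax_lt => // z.
by rewrite -eigenvalue_cmxE => /At.
Qed.

Lemma normc_ge0 {R : rcfType} (z : R[i]) : 0 <= Normc.normc z.
Proof. by case: z => a b; exact: sqrtr_ge0. Qed.

Lemma normc_real {R : rcfType} (x : R) : Normc.normc x%:C%C = `|x|.
Proof. by rewrite /= expr0n addr0 sqrtr_sqr. Qed.

(** Otherwise the real number [s >= 0] would be an eigenvalue of modulus [s]. *)
Lemma specrad_lt_unitmx {R : rcfType} {n : nat} (A : 'M[R]_n) (t s : R) :
  specrad A < t -> t <= s -> s%:M - A \in unitmx.
Proof.
move=> At ts; have s0 : 0 <= s by have := specrad_ge0 A; lra.
rewrite unitmxE unitfE; apply/negP => sA.
suff : s <= specrad A by lra.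
rewrite -(ger0_norm s0) -normc_real; apply: (@bigmax_sup_seq _ _ _ _ _ (s%:C%C)) => //.
rewrite -eigenvalue_cmxE eigenvalue_root_char /cmx -map_char_poly fmorph_root.
by rewrite /root -(horner_char_poly_mx A s) det_map_mx in sA *.
Qed.

(** * Collatz-Wielandt bounds for companion matrices *)

Lemma normc_mulmx_le {R : rcfType} {n : nat} (v : 'rV[R[i]]_n) (X : 'M[R]_n) j :
  mxle 0 X ->
  Normc.normc ((v *m cmx X) 0 j) <= (map_mx (@Normc.normc R) v *m X) 0 j.
Proof.
move=> X0; rewrite !mxE; elim/big_ind2: _ => [|x1 x2 y1 y2 H1 H2|k _].
- by rewrite Normc.normc0.
- by apply: le_trans (le_normcD _ _) _; apply: lerD.
- rewrite !mxE Normc.normcM normc_real ger0_norm //.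
  by have := X0 k j; rewrite mxE.
Qed.

Lemma mulmx_lt {R : rcfType} {n : nat} (u : 'rV[R]_n) (y z : 'cV[R]_n) :
  mxle 0 u -> u != 0 -> (forall i, y i 0 < z i 0) ->
  (u *m y) 0 0 < (u *m z) 0 0.
Proof.
move=> u0 un0 yz; have {un0} [i ui] : exists i, u 0 i != 0.
  apply/existsP; apply: contraNT un0; rewrite negb_exists => /forallP u_0.
  by apply/eqP/rowP => i; rewrite mxE; apply/eqP; rewrite -[_ == _]negbK.
have u0i k : 0 <= u 0 k by have := u0 0 k; rewrite mxE.
rewrite !mxE (bigD1 i) //= [ltRHS](bigD1 i) //=; apply: ltr_leD.
  by rewrite ltr_pM2l // lt_def ui u0i.
by apply: ler_sum => k _; apply: ler_wpM2l => //; exact/ltW.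
Qed.

(** For a left eigenvector [(v1, v2)] at [z], eliminating [v2] gives [z^2 v1 = z v1 X + v1 Y].
    Taking moduli and pairing with [y] contradicts the strict inequality as soon as [|z| >= t]. *)
Lemma specrad_companion_lt {R : rcfType} {n : nat} (X Y : 'M[R]_n) (y : 'cV[R]_n) (t : R) :
  0 < t -> mxle 0 X -> mxle 0 Y -> mxle 0 y ->
  (forall i, (t *: (X *m y) + Y *m y) i 0 < (t ^+ 2 *: y) i 0) ->
  specrad (block_mx X Y 1%:M 0) < t.
Proof.
move=> t0 X0 Y0 y0 Hy; apply: specrad_lt => // z /eigenvalueP [v vz vn0].
move: vz vn0; rewrite -[v]hsubmxK; move: (lsubmx v) (rsubmx v) => {v} v1 v2.
rewrite /cmx map_block_mx map_mx1 map_mx0 mul_row_block mulmx1 mulmx0 addr0.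
rewrite scale_row_mx => /eq_row_mx [E1 E2] vn0.
set r := Normc.normc z; rewrite ltNge; apply/negP => tr.
have r0 : 0 < r by lra.
have zn0 : z != 0 by apply: contraTneq r0 => z0; rewrite /r z0 Normc.normc0 ltxx.
have v1n0 : v1 != 0.
  apply: contraNneq vn0 => v10; move/eqP: E2; rewrite v10 mul0mx eq_sym.
  by rewrite scaler_eq0 (negbTE zn0) => /eqP ->; rewrite row_mx0.
pose u := map_mx (@Normc.normc R) v1.
have u0 : mxle 0 u by move=> i j; rewrite !mxE; exact: normc_ge0.
have un0 : u != 0.
  apply: contraNneq v1n0 => u_0; apply/eqP/rowP => j; rewrite mxE.
  by apply: Normc.eq0_normc; move/rowP/(_ j): u_0; rewrite !mxE.
have uE j : r ^+ 2 * u 0 j <= r * (u *m X) 0 j + (u *m Y) 0 j.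
  have E : z *: (z *: v1) = z *: (v1 *m cmx X) + v1 *m cmx Y.
    by rewrite -E1 scalerDr -E2.
  rewrite expr2 -mulrA [u 0 j]mxE -!Normc.normcM.
  move/rowP/(_ j): E; rewrite !mxE => ->.
  apply: le_trans (le_normcD _ _) _; apply: lerD.
    rewrite Normc.normcM; apply: ler_wpM2l; first exact: ltW.
    by have := normc_mulmx_le v1 X j X0; rewrite !mxE.
  by have := normc_mulmx_le v1 Y j Y0; rewrite !mxE.
have : r ^+ 2 * (u *m y) 0 0 <= r * (u *m (X *m y)) 0 0 + (u *m (Y *m y)) 0 0.
  rewrite !mulmxA !(mxE, mulr_sumr) -big_split; apply: ler_sum => j _ /=.
  rewrite !mulrA -mulrDl; apply: ler_wpM2r; last exact: uE.
  by have := y0 j 0; rewrite mxE.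
have := mulmx_lt u _ _ u0 un0 Hy; rewrite mulmxDr -!scalemxAr.
have a0 := mxle0_mul _ _ u0 y0 0 0.
have b0 := mxle0_mul _ _ u0 (mxle0_mul _ _ X0 y0) 0 0.
have c0 := mxle0_mul _ _ u0 (mxle0_mul _ _ Y0 y0) 0 0.
rewrite [X in X <= _]mxE in a0; rewrite [X in X <= _]mxE in b0; rewrite [X in X <= _]mxE in c0.
move: (u *m y) (u *m (X *m y)) (u *m (Y *m y)) a0 b0 c0 => a b c.
rewrite !mxE; move: (a 0 0) (b 0 0) (c 0 0) => {}a {}b {}c a0 b0 c0 lt1 le1.
have t2r2 : t ^+ 2 <= r ^+ 2 by apply: lerXn2r; rewrite ?nnegrE // ltW.
(* The factors make both bounds share the term [t^2 r^2 a]; then [t <= r] with [b, c >= 0] closes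
   the contradiction. *)
have : r ^+ 2 * (t * b + c) < r ^+ 2 * (t ^+ 2 * a) by rewrite ltr_pM2l // exprn_gt0.
have : t ^+ 2 * (r ^+ 2 * a) <= t ^+ 2 * (r * b + c) by rewrite ler_pM2l // exprn_gt0.
have : t * r * (t * b) <= t * r * (r * b).
  by rewrite ler_wpM2l ?ler_wpM2r //; apply/ltW/mulr_gt0.
have : t ^+ 2 * c <= r ^+ 2 * c by rewrite ler_wpM2r.
lra.
Qed.

(** The nonnegative resolvent is applied to [(w, 0)]: the lower block row forces the solution to be
    [(t b, b)], and the upper one is the equation for [b]. *)
Lemma companion_solve {R : rcfType} {n : nat} (X Y : 'M[R]_n) (w : 'cV[R]_n) (t : R) :
  mxle 0 X -> mxle 0 Y -> mxle 0 w -> specrad (block_mx X Y 1%:M 0) < t ->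
  exists2 b : 'cV[R]_n, mxle 0 b & t ^+ 2 *: b = t *: (X *m b) + Y *m b + w.
Proof.
move=> X0 Y0 w0; set M := block_mx X Y 1%:M 0 => Mt.
have M0 : mxle 0 M.
  move=> k l; rewrite mxE -[k]splitK -[l]splitK /M.
  case: (split k) => i'; case: (split l) => j' /=;
    rewrite ?(block_mxEul, block_mxEur, block_mxEdl, block_mxEdr).
  - by have := X0 i' j'; rewrite mxE.
  - by have := Y0 i' j'; rewrite mxE.
  - by rewrite mxE ler0n.
  - by rewrite mxE.
have N0 := resolvent_ge0 M t M0 (fun s => specrad_lt_unitmx M t s Mt).
pose x := invmx (t%:M - M) *m col_mx w 0.
have w00 : mxle 0 (col_mx w (0 : 'cV[R]_n)).
  move=> k j; rewrite mxE -[k]splitK; case: (split k) => i' /=.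
    by rewrite col_mxEu; have := w0 i' j; rewrite mxE.
  by rewrite col_mxEd mxE.
have x0 : mxle 0 x by exact: mxle0_mul.
have H : (t%:M - M) *m x = col_mx w 0.
  by rewrite mulmxA mulmxV ?mul1mx // (specrad_lt_unitmx _ t).
exists (dsubmx x) => [i j|]; first by have := x0 (rshift n i) j; rewrite !mxE.
move: H; rewrite -{1}[x]vsubmxK mulmxBl mul_scalar_mx mul_block_col scale_col_mx.
rewrite mul1mx mul0mx addr0 opp_col_mx add_col_mx => /eq_col_mx [E1 E2].
have {}E2 : usubmx x = t *: dsubmx x by apply/esym/eqP; rewrite -subr_eq0 E2.
move: E1; rewrite E2 -scalemxAr scalerA -expr2 => <-.
by rewrite addrC subrK.
Qed.

(** * Moore-Penrose inverses and proper splittings *)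

Lemma MP_colspace {R : rcfType} {m n p : nat} (P : 'M[R]_(m, n)) (Pd : 'M[R]_(n, m))
    (B : 'M[R]_(m, p)) :
  is_MP_inverse P Pd -> (colspace B <= colspace P)%MS -> P *m Pd *m B = B.
Proof.
move=> [PPP _ _ _] /submxP [D BE].
by rewrite -[B]trmxK [B^T]BE trmx_mul trmxK mulmxA PPP.
Qed.

(** The columns of [1 - Pd *m P] lie in the null space of [P], hence in that of [B]. *)
Lemma MP_nullspace {R : rcfType} {m n p : nat} (P : 'M[R]_(m, n)) (Pd : 'M[R]_(n, m))
    (B : 'M[R]_(p, n)) :
  is_MP_inverse P Pd -> (nullspace P <= nullspace B)%MS -> B *m Pd *m P = B.
Proof.
move=> [PPP _ _ _] PB; apply/eqP; rewrite -subr_eq0 -oppr_eq0 opprB -mulmxA.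
rewrite -[X in X - _]mulmx1 -mulmxBr -trmx_eq0 trmx_mul; apply/eqP/sub_kermxP.
apply: submx_trans PB; apply/sub_kermxP.
by rewrite -trmx_mul mulmxBr mulmx1 mulmxA PPP subrr trmx0.
Qed.

(* [k] is the indicator of the zero rows of [Pd], which span no part of the
   row space of [P]; it repairs the positivity of [Pd *m u] on those rows. *)
Lemma MP_positive_vector {R : rcfType} {m n : nat} (P : 'M[R]_(m, n)) (Pd : 'M[R]_(n, m)) :
  is_MP_inverse P Pd -> mxle 0 Pd ->
  exists (u : 'cV[R]_m) (k : 'cV[R]_n),
    [/\ mxle 0 u, mxle 0 k, P *m k = 0, P *m Pd *m u = u
      & forall i, 0 < (Pd *m u + k) i 0].
Proof.
move=> [PPP dPd tPd tdP] Pd0.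
have Pd0' i j : 0 <= Pd i j by have := Pd0 i j; rewrite mxE.
(* [u] lists the column sums of [Pd], so a positive entry in row [i] of [Pd] makes [(Pd *m u) i 0]
   positive. *)
pose u := Pd^T *m const_mx 1 : 'cV[R]_m; pose k := \col_i (row i Pd == 0)%:R : 'cV[R]_n.
have uE j : u j 0 = \sum_i Pd i j by rewrite mxE; apply: eq_bigr => i _; rewrite !mxE mulr1.
have u0 j : 0 <= u j 0 by rewrite uE; exact: sumr_ge0.
have kE i : k i 0 = (row i Pd == 0)%:R by rewrite mxE.
exists u, k; split.
- by move=> i j; rewrite ord1 mxE.
- by move=> i j; rewrite !mxE ler0n.
- have tk : Pd^T *m k = 0.
    apply/colP => j; rewrite !mxE big1 // => i _; rewrite !mxE.
    by case: eqP => [/rowP/(_ j)|_]; [rewrite !mxE => ->; rewrite mul0r | rewrite mulr0].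
  by rewrite -PPP -(mulmxA P) -tdP trmx_mul -!mulmxA tk !mulmx0.
- by rewrite -tPd mulmxA -trmx_mul mulmxA dPd.
- move=> i; rewrite [X in _ < X]mxE kE.
  have Pu0 : 0 <= (Pd *m u) i 0.
    by rewrite mxE; apply: sumr_ge0 => j _; apply: mulr_ge0.
  case: eqP => [_|rn0]; first by rewrite ltr_wpDl.
  rewrite addr0 lt_def Pu0 andbT; apply/eqP => Pu; apply: rn0.
  apply/rowP => j; rewrite !mxE; apply/eqP; move: Pu; rewrite mxE.
  move/psumr_eq0P => /(_ (fun l _ => mulr_ge0 (Pd0' i l) (u0 l)) j isT) /eqP.
  rewrite mulf_eq0 => /orP[//|]; rewrite uE => /eqP/psumr_eq0P.
  by move=> /(_ (fun l _ => Pd0' l j) i isT) ->.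
Qed.

(** With [u], [k] from [MP_positive_vector] and [y = Ad *m u + k], one has [A *m y = u], so the
    iteration matrix lowers [y] by exactly the positive vector [Pd *m u + k]. *)
Lemma proper_splitting_contraction {R : rcfType} {m n : nat} (A P : 'M[R]_(m, n))
    (Ad Pd : 'M[R]_(n, m)) :
  is_MP_inverse A Ad -> mxle 0 Ad -> is_MP_inverse P Pd -> mxle 0 Pd ->
  (colspace P == colspace A)%MS -> (nullspace P == nullspace A)%MS ->
  mxle 0 (Pd *m (P - A)) ->
  exists2 y : 'cV[R]_n, (forall i, 0 < y i 0)
    & forall i, (Pd *m (P - A) *m y) i 0 < y i 0.
Proof.
move=> HA Ad0 HP Pd0 /andP[PA AP] /andP[nPA nAP] G0.
have [u [k [u0 k0 Pk PPu w0]]] := MP_positive_vector P Pd HP Pd0.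
have APP : A *m Pd *m P = A by exact: MP_nullspace.
have AAu : A *m Ad *m u = u by rewrite -PPu !mulmxA (MP_colspace A Ad P).
have Ak : A *m k = 0 by rewrite -APP -mulmxA Pk mulmx0.
have PPAd : Pd *m P *m Ad = Ad.
  case: HA => _ AdE _ AdA; case: HP => _ _ _ PdP.
  (* Both factors are symmetric, so this is the transpose of [Ad *m A *m (Pd *m P) = Ad *m A]. *)
  have E : Pd *m P *m (Ad *m A) = Ad *m A.
    by rewrite -{1}PdP -{1}AdA -trmx_mul -(mulmxA Ad) (mulmxA A) APP AdA.
  by rewrite -{1}AdE mulmxA E AdE.
pose y := Ad *m u + k.
have yE : Pd *m (P - A) *m y = y - (Pd *m u + k).
  rewrite mulmxBr mulmxBl /y !mulmxDr -!mulmxA Pk Ak !mulmx0 !addr0.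
  by rewrite (mulmxA A) AAu (mulmxA P) (mulmxA Pd) mulmxA PPAd opprD addrACA subrr addr0.
have y0 : mxle 0 y by apply: mxle0_add k0; exact: mxle0_mul.
have yw0 := mxle0_mul _ _ G0 y0; rewrite yE in yw0.
exists y => i; rewrite ?yE; move: y {y0 yE} (Pd *m u + k) w0 yw0 => y w w0 yw0.
  by have := w0 i; have := yw0 i 0; rewrite !mxE; lra.
by have := w0 i; rewrite !mxE; lra.
Qed.

(** * Comparison of spectral radii *)

(** If the smaller matrix had the larger radius [t], the larger matrix's equation at [t] with
    [w = 1] would yield a Collatz-Wielandt vector for the smaller one at its own radius. *)
Lemma specrad_companion_le {R : rcfType} {n : nat} (X Y X' Y' : 'M[R]_n) :
  mxle 0 X -> mxle 0 Y -> mxle X X' -> mxle Y Y' ->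
  specrad (block_mx X Y 1%:M 0) <= specrad (block_mx X' Y' 1%:M 0).
Proof.
move=> X0 Y0 XX' YY'; rewrite leNgt; apply/negP => lt_t.
set t := specrad (block_mx X Y _ _) in lt_t *.
have t0 : 0 < t by apply: le_lt_trans lt_t; exact: specrad_ge0.
have X'0 : mxle 0 X' by move=> i j; apply: le_trans (X0 i j) (XX' i j).
have Y'0 : mxle 0 Y' by move=> i j; apply: le_trans (Y0 i j) (YY' i j).
have w0 : mxle 0 (const_mx 1 : 'cV[R]_n) by move=> i j; rewrite !mxE.
have [b b0 bE] := companion_solve X' Y' _ t X'0 Y'0 w0 lt_t.
suff : specrad (block_mx X Y 1%:M 0) < t by rewrite ltxx.
apply: (specrad_companion_lt X Y b) => // i; rewrite bE.
have /mxle_subr0/mxle0_mul/(_ b0)/(_ i 0) := XX'.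
have /mxle_subr0/mxle0_mul/(_ b0)/(_ i 0) := YY'.
rewrite !mulmxBl; move: (X *m b) (Y *m b) (X' *m b) (Y' *m b) => x y x' y'.
rewrite !mxE => yy xx; have : t * x i 0 <= t * x' i 0 by rewrite ler_pM2l //; lra.
lra.
Qed.

Lemma specrad_companion_lt1 {R : rcfType} {n : nat} (X Y : 'M[R]_n) (y : 'cV[R]_n) :
  mxle 0 X -> mxle 0 Y -> mxle 0 y -> (forall i, ((X + Y) *m y) i 0 < y i 0) ->
  specrad (block_mx X Y 1%:M 0) < 1.
Proof.
move=> X0 Y0 y0 Hy; apply: (specrad_companion_lt X Y y) => // i.
by rewrite scale1r expr1n scale1r -mulmxDl.
Qed.

Lemma exists_between_min {R : realFieldType} (a b c : R) :
  a < b -> a < c -> exists t, [/\ a < t, t <= b & t < c].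
Proof.
move=> ab ac; have [bc|cb] := ltP b c; first by exists b.
by exists ((a + c) / 2); split; lra.
Qed.

Theorem theorem3p17 (R : rcfType) (m n : nat)
  (A P1 R1 S1 P2 R2 S2 : 'M[R]_(m, n))
  (Ad P1d P2d : 'M[R]_(n, m)) (Ahatd : 'M[R]_(n, m)) :
  is_MP_inverse A Ad -> mxle 0 Ad ->
  double_proper_weak_regular A P1 R1 S1 P1d ->
  double_proper_regular A P2 R2 S2 P2d ->
  (nullspace P2 <= nullspace R2)%MS ->
  (colspace R2 <= colspace P2)%MS ->
  ~~ spectrum (R2 *m P1d) (-1) ->
  is_MP_inverse ((1%:M + R2 *m P1d) *m A) Ahatd -> mxle 0 Ahatd ->
  mxle (P2d *m R2) (P1d *m R1) ->
  mxle (P1d *m S1) (P2d *m S2) ->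
  mxle (P2d *m R2 + P2d *m S2) 0 ->
  let W12 := block_mx (P2d *m R2 *m P1d *m R1 - P2d *m S2)
                      (- (P2d *m R2 *m P1d *m S1)) 1%:M 0 in
  let T1 := block_mx (P1d *m R1) (- (P1d *m S1)) 1%:M 0 in
  let T2 := block_mx (P2d *m R2) (- (P2d *m S2)) 1%:M 0 in
  specrad W12 <= Num.min (specrad T1) (specrad T2) /\
  Num.min (specrad T1) (specrad T2) < 1.
Proof.
move=> HA Ad0 [[A1 PA1 nPA1] HP1 P1d0 X10 S1le] [[A2 PA2 nPA2] HP2 P2d0 R20 S2le].
move=> nR2 cR2 _ _ _ X21 S12 XS2 W12 T1 T2.
pose X1 := P1d *m R1; pose Y1 := - (P1d *m S1).
pose X2 := P2d *m R2; pose Y2 := - (P2d *m S2).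
have NS20 : mxle 0 (- S2) by move=> i j; have := S2le i j; rewrite !mxE; lra.
have X20 : mxle 0 X2 by exact: mxle0_mul.
have Y20 : mxle 0 Y2 by rewrite /Y2 -mulmxN; exact: mxle0_mul.
have Y10 : mxle 0 Y1 by move=> i j; have := S1le i j; rewrite !mxE; lra.
have Y21 : mxle Y2 Y1.
  by apply/mxle_subr0; rewrite /Y1 /Y2 opprK addrC; apply/mxle_subr0.
have X2Y2 : mxle X2 Y2.
  by move=> i j; have := XS2 i j; rewrite /X2 /Y2 !mxE; lra.
have T21 : specrad T2 <= specrad T1 by exact: specrad_companion_le.
have T2lt1 : specrad T2 < 1.
  have E : P2d *m (P2 - A) = X2 + Y2.
    by rewrite /X2 /Y2 -mulmxN -mulmxDr A2; congr (_ *m _); rewrite !opprD !opprK !addrA subrr add0r.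
  have [|y y0 Hy] := proper_splitting_contraction A P2 Ad P2d HA Ad0 HP2 P2d0 PA2 nPA2.
    by rewrite E; exact: mxle0_add.
  apply: (specrad_companion_lt1 _ _ y) => // [i j|i]; last by rewrite -E.
  by rewrite ord1 mxE ltW.
have -> : Num.min (specrad T1) (specrad T2) = specrad T2 by apply/min_idPr.
split; last exact: T2lt1.
rewrite leNgt; apply/negP => T2W.
(* The bound [t <= specrad W12] is what the Collatz-Wielandt estimate at [t] will contradict. *)
have [t [T2t tW t1]] := exists_between_min _ _ _ T2W T2lt1.
have t0 : 0 < t by apply: le_lt_trans T2t; exact: specrad_ge0.
suff : specrad W12 < t by rewrite ltNge tW.
have [u [k [u0 k0 P2k P2u w0]]] := MP_positive_vector P2 P2d HP2 P2d0.
have wge0 : mxle 0 (P2d *m u + k) by apply: mxle0_add k0; exact: mxle0_mul.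
have [b b0 bE] := companion_solve X2 Y2 _ t X20 Y20 wge0 T2t.
clear T21 T2lt1 T2W T2t tW.
have W12E : W12 = block_mx (X2 *m X1 + Y2) (X2 *m Y1) 1%:M 0.
  by rewrite /W12 /X1 /Y1 mulmxN !mulmxA.
have Ab0 : mxle 0 (A *m b).
  (* The range of [S2] lies in that of [P2] because [S2] is a combination of [A], [P2] and [R2]. *)
  have cS2 : P2 *m P2d *m S2 = S2.
    have -> : S2 = A - P2 + R2 by rewrite {1}A2; apply/matrixP => i j; rewrite !mxE; ring.
    rewrite mulmxDr mulmxBr (MP_colspace P2 P2d R2) // (MP_colspace P2 P2d A) //.
      by case: HP2 => -> _ _ _.
    by case/andP: PA2.
  have cR2' : P2 *m P2d *m R2 = R2 by exact: MP_colspace.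
  have P2b : t ^+ 2 *: (P2 *m b) = t *: (R2 *m b) - S2 *m b + u.
    rewrite scalemxAr bE !mulmxDr -scalemxAr P2k addr0 !mulmxA P2u /X2 /Y2.
    by rewrite mulmxN mulNmx !mulmxA cR2' cS2.
  (* Substituting [P2b] into [A = P2 - R2 + S2] leaves coefficients that are nonnegative for
     [0 < t < 1]. *)
  have AbE : t ^+ 2 *: (A *m b) =
      (t * (1 - t)) *: (R2 *m b) + (1 - t ^+ 2) *: (- S2 *m b) + u.
    rewrite {1}A2 mulmxDl mulmxBl scalerDr scalerBr P2b mulNmx.
    by apply/matrixP => i j; rewrite !mxE; ring.
  apply: (mxle0_of_scale _ _ (exprn_gt0 2 t0)).
  rewrite AbE; apply: mxle0_add u0; apply: mxle0_add; apply: mxle0_scale.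
  - by apply: mulr_ge0; lra.
  - exact: mxle0_mul.
  - by rewrite subr_ge0 exprn_ile1 ?ltW.
  - exact: mxle0_mul.
(* [P1d *m P1] disappears behind [X2], since [P1], [A] and [P2] share a null space contained in that
   of [R2]. *)
have X2A : X2 *m (P1d *m (A *m b)) = X2 *m (b - X1 *m b - Y1 *m b).
  have nR21 : (nullspace P1 <= nullspace R2)%MS.
    case/andP: nPA1 => H _; case/andP: nPA2 => _ H'.
    exact: submx_trans H (submx_trans H' nR2).
  have X2P : X2 *m P1d *m P1 = X2.
    by rewrite /X2 -!mulmxA (mulmxA R2) (MP_nullspace P1 P1d R2).
  rewrite {1}A1 /X1 /Y1 mulmxDl mulmxBl mulmxDr mulmxBr mulmxDr mulmxBr.
  by rewrite !mulmxA X2P mulmxBr mulmxBr mulNmx mulmxN opprK !mulmxA.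
have X2A0 : mxle 0 (X2 *m (P1d *m (A *m b))) by do 2!apply: mxle0_mul => //.
rewrite W12E; apply: (specrad_companion_lt _ _ b) => //.
- by apply: mxle0_add => //; exact: mxle0_mul.
- exact: mxle0_mul.
move=> i; rewrite bE.
have slack : t *: (X2 *m b) + Y2 *m b - (t *: ((X2 *m X1 + Y2) *m b) + X2 *m Y1 *m b) =
    (1 - t) *: ((Y2 - X2) *m b) + (1 - t) *: (X2 *m X1 *m b) +
    X2 *m (P1d *m (A *m b)).
  rewrite X2A !mulmxBr mulmxDl mulmxBl !mulmxA.
  by apply/matrixP => l j; rewrite !mxE; ring.
have : mxle 0 (t *: (X2 *m b) + Y2 *m b - (t *: ((X2 *m X1 + Y2) *m b) + X2 *m Y1 *m b)).
  have t1' : 0 <= 1 - t by rewrite subr_ge0 ltW.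
  rewrite slack; apply: mxle0_add X2A0; apply: mxle0_add; apply: mxle0_scale t1' _.
    by apply: mxle0_mul b0; apply/mxle_subr0.
  by apply: mxle0_mul b0; exact: mxle0_mul.
(* Strictness comes from the positive term [P2d *m u + k] in the equation for [b]. *)
move/mxle_subr0/(_ i 0) => le_b; apply: (le_lt_trans le_b).
by rewrite [X in _ < X]mxE ltrDl.
Qed.
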